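(* Let $\mathcal{A}$ and $\mathcal{C}$ be unital complex algebras and let $\varphi:\mathcal{A}\to\mathcal{C}$ be a linear map with $\varphi(1)=1$. If $X,Y\in\mathcal{A}$ are boolean independent with respect to $\varphi$, then $$B_{(1+X)(1+Y)}(z)=B_{1+X}(z)\cdot B_{1+Y}(z)$$ as formal power series in $z$ with coefficients in $\mathcal{C}$.
   Context: Neither $\mathcal{A}$ nor $\mathcal{C}$ is assumed commutative. Subalgebras of $\mathcal{A}$ are not required to contain the unit of $\mathcal{A}$. Subalgebras $\mathcal{A}_1,\mathcal{A}_2$ of $\mathcal{A}$ are boolean independent (with respect to $\varphi$) if for every finite alternating product whose factors come alternately from $\mathcal{A}_1$ and $\mathcal{A}_2$ (starting with either one), $\varphi$ of the product equals the product, in the same order, of the values of $\varphi$ on the factors, e.g. $\varphi(X_1Y_1X_2\cdots)=\varphi(X_1)\varphi(Y_1)\varphi(X_2)\cdots$ for $X_i\in\mathcal{A}_1$, $Y_i\in\mathcal{A}_2$. Elements $X,Y\in\mathcal{A}$ are boolean independent if $X\in\mathcal{A}_1$ and $Y\in\mathcal{A}_2$ for some boolean independent subalgebras $\mathcal{A}_1,\mathcal{A}_2$ of $\mathcal{A}$ (equivalently, the non-unital subalgebras they generate are boolean independent). The boolean cumulants are the multilinear maps $b^n:\mathcal{A}^n\to\mathcal{C}$, $n\ge1$, defined recursively by $$\varphi(a_1\cdots a_n)=\sum_{k=1}^{n}b^k(a_1,\dots,a_k)\,\varphi(a_{k+1}\cdots a_n),$$ where for $k=n$ the empty product is $1$,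 so the last term is $b^n(a_1,\dots,a_n)$. Write $b^n_X=b^n(X,\dots,X)$ and $B_X(z)=\sum_{n=1}^\infty b^n_X z^{n-1}\in\mathcal{C}[[z]]$, where $z$ commutes with $\mathcal{C}$. *)

(* Defs.v *)
From HB Require Import structures.
From mathcomp Require Import all_boot all_order all_algebra.
From mathcomp Require Import classical_sets reals.

Set Implicit Arguments.
Unset Strict Implicit.
Unset Printing Implicit Defensive.

Import Order.TTheory GRing.Theory Num.Theory.
Local Open Scope ring_scope.

(* Formal power series in a central variable, as coefficient sequences; the
   coefficient ring is not assumed commutative. *)
Definition fps (K : pzRingType) := nat -> K.

Definition fps_mul (K : pzRingType) (f g : fps K) : fps K :=
  fun n => \sum_(i < n.+1) f i * g (n - i)%N.

Section BooleanProbability.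
Variables (K : pzRingType) (A C : algType K) (phi : {linear A -> C}).

(* The unit of [A] need not belong to [S]. *)
Definition is_subalgebra (S : set A) : Prop :=
  GRing.submod_closed [in S] /\ GRing.mulr_2closed [in S].

(* The factors come alternately from [S1] and [S2], starting with [S1]. *)
Fixpoint alternating (S1 S2 : set A) (s : seq A) : Prop :=
  if s is a :: s' then a \in S1 /\ alternating S2 S1 s' else True.

Definition boolean_independent_subalgebras (S1 S2 : set A) : Prop :=
  forall s : seq A, alternating S1 S2 s \/ alternating S2 S1 s ->
  phi (\prod_(a <- s) a) = \prod_(a <- s) phi a.

Definition boolean_independent (X Y : A) : Prop :=
  exists S1 S2 : set A,
    [/\ is_subalgebra S1, is_subalgebra S2,
        boolean_independent_subalgebras S1 S2, X \in S1 & Y \in S2].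

(* [fuel] only bounds the recursion depth: see [boolean_cumulant_moment] for
   the recursion that defines the cumulants. *)
Fixpoint boolean_cumulant_rec (fuel : nat) (s : seq A) : C :=
  if fuel is m.+1 then
    phi (\prod_(a <- s) a) -
    \sum_(1 <= k < size s)
       boolean_cumulant_rec m (take k s) * phi (\prod_(a <- drop k s) a)
  else 0.

(* [boolean_cumulant [:: a_1; ...; a_n]] is b^n(a_1, ..., a_n) for n >= 1;
   the value at [[::]] is irrelevant. *)
Definition boolean_cumulant (s : seq A) : C := boolean_cumulant_rec (size s) s.

Lemma boolean_cumulant_rec_fuel m s :
  (size s <= m)%N -> s != [::] -> boolean_cumulant_rec m s = boolean_cumulant s.
Proof.
suff H p q t : t != [::] -> (size t <= p)%N -> (size t <= q)%N ->
    boolean_cumulant_rec p t = boolean_cumulant_rec q t.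
  by move=> sm s0; apply: H.
elim: p q t => [|p IH] [|q] [|a t] //= _ tp tq.
congr (_ - _); rewrite !big_nat; apply: eq_bigr => k /andP[k0 kt].
have sk : size (take k (a :: t)) = k by rewrite size_takel // ltnW.
congr (_ * _); apply: IH.
- by rewrite -size_eq0 sk -lt0n.
- by rewrite sk -ltnS (leq_trans kt).
- by rewrite sk -ltnS (leq_trans kt).
Qed.

Lemma boolean_cumulant_moment (s : seq A) : phi 1 = 1 -> s != [::] ->
  phi (\prod_(a <- s) a) =
  \sum_(1 <= k < (size s).+1)
     boolean_cumulant (take k s) * phi (\prod_(a <- drop k s) a).
Proof.
move=> phi1; case: s => [//|a s] _.
rewrite big_nat_recr //= drop_size big_nil phi1 mulr1 take_size.
rewrite [boolean_cumulant (a :: s)]/boolean_cumulant /=.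
rewrite [X in _ = X + _](_ : _ = \sum_(1 <= k < (size s).+1)
    boolean_cumulant_rec (size s) (take k (a :: s)) *
    phi (\prod_(b <- drop k (a :: s)) b)); first by rewrite addrC subrK.
rewrite !big_nat; apply: eq_bigr => k /andP[k0 kt].
have sk : size (take k (a :: s)) = k by rewrite size_takel // ltnW.
by rewrite boolean_cumulant_rec_fuel ?sk // -size_eq0 sk -lt0n.
Qed.

Lemma boolean_cumulant_unique (b : seq A -> C) : phi 1 = 1 ->
  (forall s, s != [::] -> phi (\prod_(a <- s) a) =
    \sum_(1 <= k < (size s).+1) b (take k s) * phi (\prod_(a <- drop k s) a)) ->
  forall s, s != [::] -> b s = boolean_cumulant s.
Proof.
move=> phi1 bE s; have [n] := ubnP (size s).
elim: n s => // n IH [//|a s] sn _.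
have := bE (a :: s) isT; rewrite boolean_cumulant_moment //.
rewrite !(@big_nat_recr _ _ _ (size (a :: s))) //= drop_size take_size.
rewrite big_nil phi1 !mulr1.
rewrite [X in X + _ = _](_ : _ = \sum_(1 <= k < (size s).+1)
    b (take k (a :: s)) * phi (\prod_(c <- drop k (a :: s)) c)).
  by move/addrI.
rewrite !big_nat; apply: eq_bigr => k /andP[k0 kt].
have sk : size (take k (a :: s)) = k by rewrite size_takel // ltnW.
congr (_ * _); apply/esym/IH; last by rewrite -size_eq0 sk -lt0n.
by rewrite sk (leq_trans kt).
Qed.

(* B_X(z) = sum_(n >= 1) b^n(X, ..., X) z^(n-1). *)
Definition boolean_series (X : A) : fps C :=
  fun n => boolean_cumulant (nseq n.+1 X).

End BooleanProbability.

(* Main.v *)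
Require Import Defs.
From mathcomp Require Import all_boot all_order all_algebra.
From mathcomp Require Import boolp classical_sets reals complex.

Set Implicit Arguments.
Unset Strict Implicit.
Unset Printing Implicit Defensive.

Import Order.TTheory GRing.Theory Num.Theory.
Local Open Scope ring_scope.

(** Pretend that [phi w] is the vacuum expectation of an operator [w], and let
    [Q] be the projection onto the orthogonal complement of the vacuum, so that
    [Q w] stands for [w - phi w].  Expanding each [Q] shows that the n-th
    boolean cumulant of [a] is [phi (a Q a Q ... Q a)] with [n] factors [a].
    The values of [phi] do not act on [A], so [Q] does not exist as an operator,
    but the functionals [w |-> phi (a Q a Q ... a Q w)] do: this is
    [centred phi a n], and [boolean_series_centred] expresses the cumulants
    through it.

    Put [u = 1 + X] and [v = 1 + Y].  In the model of boolean independence, the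
    orthogonal complement of the vacuum splits as the sum of [H1] and [H2], where
    [X] kills [H2] and [Y] kills [H1].  Thus [u] is the identity on [H2] and [v] is
    the identity on [H1].  The functional [centred phi u n.+1] is a row vector
    supported in [H1], hence is unchanged by a right multiplication by [v], and
    [centred phi v n.+1] is unchanged by [u]: this is [centred_succ_mul1D], which
    is where independence is used.  Starting from the vacuum row vector and
    applying [u v Q] repeatedly, one stays in [H1] under the action of [u Q]
    until some step returns to the vacuum between [u] and [v]; this costs a
    cumulant of [u], and afterwards only the action of [v Q] is seen.  So
    [centred phi (u * v) n] is [centred phi u n] plus the sum, over the step [i]
    of the return, of the [i]-th cumulant of [u] times [centred phi v (n - i)].
    Evaluating at [u * v] yields the convolution of the cumulants of [u] and
    [v]. *)

(** * Centred functionals and boolean cumulants *)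

Section Centred.
Variables (K : pzRingType) (A C : algType K) (phi : {linear A -> C}).

(** The functional [w |-> phi (a Q a Q ... a Q w)] with [n] factors [a], where
    [Q w] stands for [w - phi w]. *)
Fixpoint centred (a : A) (n : nat) (w : A) : C :=
  if n is m.+1 then centred a m (a * w) - centred a m a * phi w else phi w.

Lemma centredD a n w w' : centred a n (w + w') = centred a n w + centred a n w'.
Proof.
elim: n w w' => [|n IH] w w' /=; first exact: linearD.
by rewrite mulrDr IH linearD mulrDr opprD addrACA.
Qed.

Lemma centred_mul a n w :
  centred a n (a * w) = centred a n a * phi w + centred a n.+1 w.
Proof. by rewrite /= addrC subrK. Qed.

(** The innermost [Q] kills the unit. *)
Lemma centred_succ1 a n : phi 1 = 1 -> centred a n.+1 1 = 0.
Proof. by move=> phi1 /=; rewrite phi1 !mulr1 subrr. Qed.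

(** Write each product in [a * a * ... * a * w] as a vacuum part plus a part
    with [Q] inserted, and sort by the leftmost vacuum part. *)
Lemma moment_centred a n w :
  phi (a ^+ n * w) =
  \sum_(i < n) centred a i a * phi (a ^+ (n - i.+1) * w) + centred a n w.
Proof.
elim: n w => [|n IH] w; first by rewrite big_ord0 add0r expr0 mul1r.
rewrite exprSr -mulrA IH centred_mul addrA; congr (_ + _).
rewrite big_ord_recr /= subnn expr0 mul1r; congr (_ + _).
apply: eq_bigr => i _.
by rewrite subSS -(subnSK (ltn_ord i)) exprSr -mulrA.
Qed.

Lemma prod_nseq n (a : A) : \prod_(b <- nseq n a) b = a ^+ n.
Proof. by elim: n => [|n IH]; rewrite ?big_nil // big_cons IH exprS. Qed.

(** Both sides solve the recursion that determines the cumulants from the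
    moments: for the right side this is [moment_centred] at [w = 1]. *)
Lemma boolean_series_centred a n : phi 1 = 1 ->
  boolean_series phi a n = centred a n a.
Proof.
move=> phi1; elim/ltn_ind: n => n IH.
have /(_ isT) := @boolean_cumulant_moment _ _ _ phi (nseq n.+1 a) phi1.
rewrite prod_nseq size_nseq big_add1 big_mkord /=.
rewrite -[a ^+ n.+1]mulr1 moment_centred centred_succ1 //.
rewrite addr0 !big_ord_recr /= take_nseq // drop_nseq subnn prod_nseq expr0.
rewrite subnn expr0 mul1r phi1 !mulr1.
rewrite [X in X + _ = _](_ : _ = \sum_(i < n)
    boolean_cumulant phi (a :: take i (nseq n a)) *
    phi (\prod_(b <- drop i (nseq n a)) b)).
  by move/addrI.
apply: eq_bigr => i _; rewrite mulr1 -IH // take_nseq ?(ltnW (ltn_ord i)) //.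
by rewrite drop_nseq prod_nseq subSS.
Qed.

End Centred.

(** * Sums of alternating products *)

Section Independent.
Variables (K : pzRingType) (A C : algType K) (phi : {linear A -> C}).
Hypothesis phi1 : phi 1 = 1.

(** The empty word is alternating, so this contains the unit. *)
Inductive alternating_span (S1 S2 : set A) : A -> Prop :=
| AlternatingSpan0 : alternating_span S1 S2 0
| AlternatingSpanW s : alternating S1 S2 s ->
    alternating_span S1 S2 (\prod_(a <- s) a)
| AlternatingSpanD p q : alternating_span S1 S2 p -> alternating_span S1 S2 q ->
    alternating_span S1 S2 (p + q).

Lemma alternating_span1 S1 S2 : alternating_span S1 S2 1.
Proof. by have := @AlternatingSpanW S1 S2 [::] I; rewrite big_nil. Qed.

Lemma boolean_independent_subalgebrasC S1 S2 :
  boolean_independent_subalgebras phi S1 S2 ->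
  boolean_independent_subalgebras phi S2 S1.
Proof. by move=> ind s [] alt; apply: ind; [right|left]. Qed.

Lemma alternating_span_phi S1 S2 x p :
  boolean_independent_subalgebras phi S1 S2 -> x \in S1 ->
  alternating_span S2 S1 p -> phi (x * p) = phi x * phi p.
Proof.
move=> ind xS; elim=> [|s alt|q r _ IHq _ IHr].
- by rewrite mulr0 linear0 mulr0.
- have := ind (x :: s) (or_introl (conj xS alt)).
  by rewrite !big_cons => ->; rewrite (ind s) //; right.
- by rewrite mulrDr !linearD IHq IHr mulrDr.
Qed.

Lemma alternating_span_cons S1 S2 x p : x \in S1 ->
  alternating_span S2 S1 p -> alternating_span S1 S2 (x * p).
Proof.
move=> xS; elim=> [|s alt|q r _ IHq _ IHr].
- rewrite mulr0; exact: AlternatingSpan0.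
- by have := @AlternatingSpanW S1 S2 (x :: s) (conj xS alt); rewrite big_cons.
- by rewrite mulrDr; apply: AlternatingSpanD.
Qed.

(** A letter of [S1] is absorbed by the first letter of the word. *)
Lemma alternating_span_absorb S1 S2 x p : is_subalgebra S1 -> x \in S1 ->
  alternating_span S1 S2 p -> alternating_span S1 S2 (x * p).
Proof.
move=> [_ mulS] xS; elim=> [|[|y s] alt|q r _ IHq _ IHr].
- rewrite mulr0; exact: AlternatingSpan0.
- by have := @AlternatingSpanW S1 S2 [:: x] (conj xS I); rewrite big_cons.
- case: alt => yS alt.
  have := @AlternatingSpanW S1 S2 (x * y :: s) (conj (mulS _ _ xS yS) alt).
  by rewrite !big_cons mulrA.
- by rewrite mulrDr; apply: AlternatingSpanD.
Qed.

(** All sums of products of letters from two subalgebras [S1] and [S2]: merging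
    neighbours makes any such product alternating.  The scalar multiples of [1]
    are left out, since only products of [1 + x] and [1 + y] are to be expanded. *)
Definition joint_span (S1 S2 : set A) (w : A) : Prop :=
  exists p q, [/\ w = p + q, alternating_span S1 S2 p & alternating_span S2 S1 q].

Lemma joint_spanC S1 S2 w : joint_span S1 S2 w -> joint_span S2 S1 w.
Proof. by move=> [p [q [-> pS qS]]]; exists q, p; split=> //; apply: addrC. Qed.

Lemma joint_span1 S1 S2 : joint_span S1 S2 1.
Proof.
exists 1, 0; split; first by rewrite addr0.
- exact: alternating_span1.
- exact: AlternatingSpan0.
Qed.

Lemma joint_span_mul S1 S2 x w : is_subalgebra S1 -> x \in S1 ->
  joint_span S1 S2 w -> alternating_span S1 S2 (x * w).
Proof.
move=> subS xS [p [q [-> pS qS]]]; rewrite mulrDr; apply: AlternatingSpanD.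
- exact: alternating_span_absorb.
- exact: alternating_span_cons.
Qed.

Lemma joint_span_mul1D S1 S2 x w : is_subalgebra S1 -> x \in S1 ->
  joint_span S1 S2 w -> joint_span S1 S2 ((1 + x) * w).
Proof.
move=> subS xS wS; have := joint_span_mul subS xS wS.
case: wS => p [q [wE pS qS]] xwS; exists (p + x * w), q; split=> //.
- by rewrite mulrDl mul1r addrAC -wE.
- exact: AlternatingSpanD.
Qed.

(** * Independence and centred functionals *)

(** A word starting in [S2] meets an operator built from [S1] only through the
    vacuum, so it factors out.  The two parts are proved together because
    multiplication by [1 + x] mixes them. *)
Lemma centred_alternating S1 S2 x n p : is_subalgebra S1 ->
  boolean_independent_subalgebras phi S1 S2 -> x \in S1 ->
  alternating_span S2 S1 p ->
  centred phi (1 + x) n p = centred phi (1 + x) n 1 * phi p /\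
  forall y, y \in S1 ->
    centred phi (1 + x) n (y * p) = centred phi (1 + x) n y * phi p.
Proof.
move=> [[_ linS] mulS] ind xS pS.
have mul1DS y : y \in S1 -> (1 + x) * y \in S1.
  move=> yS; rewrite mulrDl mul1r -[y in y + _]scale1r.
  by apply: linS => //; apply: mulS.
elim: n => [|n [IH1 IH]].
  split=> [|y yS]; first by rewrite /= phi1 mul1r.
  exact: alternating_span_phi ind yS pS.
split=> [|y yS] /=.
- rewrite phi1 !mulr1 subrr mul0r mulrDl mul1r !centredD IH1 (IH _ xS).
  by rewrite -mulrDl subrr.
- rewrite mulrA (IH _ (mul1DS _ yS)) (alternating_span_phi ind yS pS).
  by rewrite mulrBl mulrA.
Qed.

(** The row vector [centred phi (1 + x) n.+1] is supported in the summand [H1]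
    of the complement of the vacuum, and [1 + y] is the identity there. *)
Lemma centred_succ_mul1D S1 S2 x y n w : is_subalgebra S1 -> is_subalgebra S2 ->
  boolean_independent_subalgebras phi S1 S2 -> x \in S1 -> y \in S2 ->
  joint_span S1 S2 w ->
  centred phi (1 + x) n.+1 ((1 + y) * w) = centred phi (1 + x) n.+1 w.
Proof.
move=> sub1 sub2 ind xS yS /joint_spanC wS.
have ywS := joint_span_mul sub2 yS wS.
rewrite mulrDl mul1r centredD.
have [-> _] := centred_alternating n.+1 sub1 ind xS ywS.
by rewrite centred_succ1 // mul0r addr0.
Qed.

Section Product.
Variables (S1 S2 : set A) (x y : A).
Hypotheses (sub1 : is_subalgebra S1) (sub2 : is_subalgebra S2).
Hypothesis ind : boolean_independent_subalgebras phi S1 S2.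
Hypotheses (xS : x \in S1) (yS : y \in S2).
Let u := 1 + x.
Let v := 1 + y.

(** Apply one more factor [u * v] to the row vector, before the vacuum is
    projected out: either [u] leads to [H1], where [v] does nothing; or [u]
    leads to the vacuum, which gives the term [i = n] of the sum; or the row
    vector was already in [H2], where [u] does nothing. *)
Lemma centred_prod_mul n w : joint_span S1 S2 w ->
  (forall w', joint_span S1 S2 w' ->
   centred phi (u * v) n w' = centred phi u n w' +
     \sum_(i < n) centred phi u i u * centred phi v (n - i) w') ->
  centred phi (u * v) n (u * v * w) = centred phi u n.+1 w +
    \sum_(i < n.+1) centred phi u i u * centred phi v (n - i) (v * w).
Proof.
move=> wS IH.
have vwS : joint_span S1 S2 (v * w).
  by apply/joint_spanC/joint_span_mul1D/joint_spanC.
rewrite -mulrA IH; last exact: joint_span_mul1D.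
rewrite centred_mul (centred_succ_mul1D n sub1 sub2 ind xS yS wS).
rewrite [X in X + _ = _]addrC -addrA; congr (_ + _).
rewrite big_ord_recr /= subnn addrC; congr (_ + _).
apply: eq_bigr => i _; congr (_ * _).
rewrite -(subnSK (ltn_ord i)).
apply: (centred_succ_mul1D _ sub2 sub1) => //.
- exact: boolean_independent_subalgebrasC.
- exact: joint_spanC.
Qed.

Lemma centred_prod n w : joint_span S1 S2 w ->
  centred phi (u * v) n w = centred phi u n w +
    \sum_(i < n) centred phi u i u * centred phi v (n - i) w.
Proof.
elim: n w => [|n IH] w wS; first by rewrite big_ord0 addr0.
have := centred_prod_mul (joint_span1 S1 S2) IH.
rewrite !mulr1 centred_succ1 // add0r => cumE.
rewrite [LHS]/= centred_prod_mul // cumE -addrA; congr (_ + _).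
rewrite mulr_suml -sumrB; apply: eq_bigr => i _.
by rewrite -mulrA -mulrBr subSn // -ltnS.
Qed.

Lemma centred_prod_cumulant n :
  centred phi (u * v) n (u * v) =
  \sum_(i < n.+1) centred phi u i u * centred phi v (n - i) v.
Proof.
have := centred_prod_mul (joint_span1 S1 S2) (@centred_prod n).
by rewrite !mulr1 centred_succ1 // add0r.
Qed.

End Product.

End Independent.

Theorem corollary3p7 (R : realType) (A C : algType R[i])
    (phi : {linear A -> C}) (phi1 : phi 1 = 1) (X Y : A)
    (indep : boolean_independent phi X Y) :
  boolean_series phi ((1 + X) * (1 + Y)) =
  fps_mul (boolean_series phi (1 + X)) (boolean_series phi (1 + Y)).
Proof.
case: indep => S1 [S2 [sub1 sub2 ind XS YS]]; apply/funext => n.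
rewrite boolean_series_centred // (centred_prod_cumulant phi1 sub1 sub2 ind) //.
by apply: eq_bigr => i _; rewrite !boolean_series_centred.
Qed.
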